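(* Let $\alpha\in\mathbb{R}$ and let $A:S^1\to\mathrm{SL}_2(\mathbb{R})$ be continuous, regarded as a discrete-time cocycle in $\mathrm{SL}_2(\mathbb{R})$ over the circle rotation by $\alpha$. Then there is a continuous-time cocycle $\Phi$ in $\mathrm{SL}_3(\mathbb{R})$ over the suspension flow by $\frac12\alpha$ that satisfies $$\Phi^n_{(\theta,0)}(v,w) = (A^n_{2\theta}v,\ w),\qquad \forall n\in\mathbb{Z},$$ for all $\theta\in S^1$ and all $v\in\mathbb{R}^2$, $w\in\mathbb{R}$.
   Context: Elements of $\mathbb{R}^3$ are written $x=(v,w)$ with $v\in\mathbb{R}^2$, $w\in\mathbb{R}$. The circle $S^1$ is $[0,1]$ with endpoints identified (i.e. $\mathbb{R}/\mathbb{Z}$); $2\theta$ is taken mod $1$. The circle rotation by $\beta\in\mathbb{R}$ is $\phi:S^1\to S^1$, $\phi(\theta)=\theta+\beta \bmod 1$. Discrete-time cocycle over the rotation $\phi$ by $\alpha$: for continuous $A:S^1\to\mathrm{SL}_2(\mathbb{R})$, $\theta\mapsto A_\theta$, the $n$-step map ($n\in\mathbb{Z}$) is $A^n_\theta = A_{\phi^{n-1}\theta}\cdots A_{\phi\theta}A_\theta$ for $n>0$, $A^0_\theta=\mathrm{Id}$, and $A^n_\theta = A^{-1}_{\phi^{n}\theta}\cdots A^{-1}_{\phi^{-2}\theta}A^{-1}_{\phi^{-1}\theta}$ for $n<0$ (so $A^n_\theta$ is never the matrix power). Here $A^n_{2\theta}$ denotes the $n$-step map, with respect to the rotation by $\alpha$,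 at the point $2\theta$. Suspension flow by $\beta\in\mathbb{R}$: on the mapping torus $\Theta_1=(S^1\times[0,1])/\sim$ with $(\theta,1)\sim(\theta+\beta \bmod 1,0)$ and the quotient topology, it is the flow $\phi^t(\theta,r) = (\theta+\lfloor r+t\rfloor\beta,\ r+t) \bmod 1$, $t\in\mathbb{R}$. Continuous-time cocycle in $\mathrm{SL}_d(\mathbb{R})$ over a suspension flow $\phi^t$: the map $\Phi:\Theta_1\times\mathbb{R}\to\mathrm{SL}_d(\mathbb{R})$, $((\theta,r),t)\mapsto\Phi^t_{(\theta,r)}$, generated by a continuous map $G:\Theta_1\to\mathfrak{sl}_d(\mathbb{R})$ (real trace-zero $d\times d$ matrices), i.e. the unique solution of $\Phi^0_{(\theta,r)}=\mathrm{Id}$, $\partial_t\Phi^t_{(\theta,r)} = G(\phi^t(\theta,r))\,\Phi^t_{(\theta,r)}$. *)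

(* Defs.v *)
From HB Require Import structures.
From mathcomp Require Import all_boot all_order all_algebra.
From mathcomp Require Import all_classical all_reals all_analysis.
From mathcomp Require Import generic_quotient ring_quotient ring.

Set Implicit Arguments.
Unset Strict Implicit.
Unset Printing Implicit Defensive.

Import Order.TTheory GRing.Theory Num.Theory.
Import numFieldNormedType.Exports.

Local Open Scope classical_set_scope.
Local Open Scope ring_scope.
Local Open Scope quotient_scope.

(* S^1 = R/Z: the quotient group, with the quotient topology. [circle] does not
   go through [quotient_topology], whose choice structure differs from the one
   underlying the quotient group. *)
Section Circle.
Variable R : realType.

Definition circle : Type :=
  Quotient.quot (GRing.ZmodClosed.clone R (@Num.int_num_subdef R) _).

HB.instance Definition _ := ZmodQuotient.on circle.

Definition circle_open (U : set circle) : Prop := open (\pi_circle @^-1` U).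

Let circle_openT : circle_open setT.
Proof. by rewrite /circle_open preimage_setT; exact: openT. Qed.

Let circle_openI (U V : set circle) :
  circle_open U -> circle_open V -> circle_open (U `&` V).
Proof. by move=> oU oV; apply: openI. Qed.

Let circle_open_bigU (I : Type) (f : I -> set circle) :
  (forall i, circle_open (f i)) -> circle_open (\bigcup_i f i).
Proof. by move=> of_; apply: bigcup_open => i _; apply: of_. Qed.

HB.instance Definition _ :=
  isOpenTopological.Build circle circle_openT circle_openI circle_open_bigU.

Definition rotation (beta : R) (theta : circle) : circle :=
  theta + \pi_circle beta.

Lemma rotationD (a b : R) (theta : circle) :
  rotation (a + b) theta = rotation a (rotation b theta).
Proof.
have piD : \pi_circle (a + b) = \pi_circle a + \pi_circle b :> circle.
  exact: (pi_addr (s := circle)).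
by rewrite /rotation piD (addrC (\pi_circle a)) addrA.
Qed.

End Circle.

Section SuspensionFlow.
Variables (R : realType) (beta : R).

Definition unit_itv : Type := set_type (`[0, 1]%classic : set R).
HB.instance Definition _ := Topological.on unit_itv.
HB.instance Definition _ := SubType.on unit_itv.

Definition glue1 (p q : circle R * unit_itv) : bool :=
  [&& \val p.2 == 1, \val q.2 == 0 & q.1 == rotation beta p.1].

(* The equivalence relation generated by (theta, 1) ~ (theta + beta, 0): the
   only classes with more than one element are pairs of such points. *)
Definition glue (p q : circle R * unit_itv) : bool :=
  [|| p == q, glue1 p q | glue1 q p].

Let glue_refl : reflexive glue.
Proof. by move=> p; rewrite /glue eqxx. Qed.

Let glue_sym : symmetric glue.
Proof. by move=> p q; rewrite /glue eq_sym orbCA orbC -orbA orbC -orbA. Qed.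

Let glue_trans : transitive glue.
Proof.
have one0 (p : circle R * unit_itv) : \val p.2 == 1 -> \val p.2 == 0 -> False.
  by move=> /eqP->; rewrite oner_eq0.
move=> q p r /or3P[/eqP->// | pq | qp] /or3P[/eqP<- | qr | rq].
- by rewrite /glue pq orbT.
- by case/and3P: pq => _ q0 _; case/and3P: qr => /one0 /(_ q0).
- case/and3P: pq => p1 q0 /eqP qE; case/and3P: rq => r1 _; rewrite qE => /eqP.
  move=> /addIr pr; rewrite /glue -pair_eqE /= pr eqxx /=.
  by rewrite -val_eqE (eqP p1) eq_sym r1.
- by rewrite /glue qp !orbT.
- case/and3P: qp => q1 p0 /eqP pE; case/and3P: qr => _ r0 /eqP rE.
  rewrite /glue -pair_eqE /= pE rE eqxx /=.
  by rewrite -val_eqE (eqP p0) eq_sym r0.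
- by case/and3P: qp => q1 _ _; case/and3P: rq => _ /(one0 _ q1).
Qed.

Canonical glue_equiv := EquivRel glue glue_refl glue_sym glue_trans.

Definition mapping_torus : Type := quotient_topology {eq_quot glue}.
HB.instance Definition _ := Topological.on mapping_torus.
HB.instance Definition _ := Quotient.on mapping_torus.

Lemma frac_itv (x : R) : x - (Num.floor x)%:~R \in (`[0, 1]%classic : set R).
Proof.
rewrite mem_setE in_itv /= subr_ge0 floor_le_tmp /= lerBlDl ltW //.
by rewrite -intrD1 floorD1_gt.
Qed.

Definition frac (x : R) : unit_itv := 
  exist (fun y => y \in (`[0, 1]%classic : set R)) _ (frac_itv x).

Definition susp_flow_lift (t : R) (p : circle R * unit_itv) : mapping_torus :=
  let s := \val p.2 + t in
  \pi_mapping_torus (rotation ((Num.floor s)%:~R * beta) p.1, frac s).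

Definition susp_flow (t : R) (x : mapping_torus) : mapping_torus :=
  susp_flow_lift t (repr x).

Let floorD1 (x : R) : Num.floor (1 + x) = Num.floor x + 1.
Proof. by rewrite addrC floorDrz ?floor1 ?int_num1. Qed.

Let susp_flow_lift_glue1 (t : R) (p q : circle R * unit_itv) :
  glue1 p q -> susp_flow_lift t p = susp_flow_lift t q.
Proof.
case/and3P => /eqP p1 /eqP q0 /eqP qE.
rewrite /susp_flow_lift p1 q0 qE add0r floorD1 intrD mulrDl mul1r rotationD.
congr (\pi_mapping_torus (_, _)); apply: val_inj => /=.
by rewrite floorD1 intrD; ring.
Qed.

(* The flow does not depend on the representative chosen by [repr]. *)
Lemma susp_flow_pi (t : R) (p : circle R * unit_itv) :
  susp_flow t (\pi_mapping_torus p) = susp_flow_lift t p.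
Proof.
rewrite /susp_flow; case: piP => q /eqmodP /or3P[/eqP-> // | pq | qp].
- exact/esym/susp_flow_lift_glue1.
- exact: susp_flow_lift_glue1.
Qed.

(* The point (theta, 0): [frac 0] is 0. *)
Definition base_point (theta : circle R) : mapping_torus :=
  \pi_mapping_torus (theta, frac 0).

End SuspensionFlow.

Section DiscreteCocycle.
Variables (R : realType) (alpha : R) (d : nat) (A : circle R -> 'M[R]_d.+1).

(* [rotation (k%:~R * alpha)] is the k-th iterate, k in Z, of the rotation by
   [alpha]. The iterates decrease from m - 1 to 0 in the first product, and
   increase from n to -1 (with n = - m.+1) in the second one. *)
Definition nstep (n : int) (theta : circle R) : 'M[R]_d.+1 :=
  match n with
  | Posz m =>
      \prod_(i < m) A (rotation ((m%:Z - 1 - i%:Z)%:~R * alpha) theta)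
  | Negz m =>
      \prod_(i < m.+1)
        invmx (A (rotation ((n + i%:Z)%:~R * alpha) theta))
  end.

End DiscreteCocycle.

Section ContinuousCocycle.
Variables (R : realType) (beta : R) (d : nat).

(* The solution of this linear differential equation is unique, so [generated_by]
   determines [Phi] from [G]. *)
Definition generated_by (G : mapping_torus beta -> 'M[R]_d)
    (Phi : mapping_torus beta -> R -> 'M[R]_d) : Prop :=
  forall x, Phi x 0 = 1%:M /\
    forall t : R, is_derive t 1 (Phi x) (G (susp_flow t x) *m Phi x t).

Definition SL_cocycle (Phi : mapping_torus beta -> R -> 'M[R]_d) : Prop :=
  (forall x t, \det (Phi x t) = 1) /\
  exists G : mapping_torus beta -> 'M[R]_d,
    [/\ continuous G, forall x, \tr (G x) = 0 & generated_by G Phi].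

End ContinuousCocycle.

(* Main.v *)
Require Import Defs.
From mathcomp Require Import all_boot all_order all_algebra.
From mathcomp Require Import all_classical all_reals all_analysis.
From mathcomp Require Import fingroup perm generic_quotient ring_quotient.
From mathcomp Require Import ring lra.

Set Implicit Arguments.
Unset Strict Implicit.
Unset Printing Implicit Defensive.

Import Order.TTheory GRing.Theory Num.Theory.
Import numFieldNormedType.Exports.

Local Open Scope classical_set_scope.
Local Open Scope ring_scope.
Local Open Scope quotient_scope.

(** Write [E(M)] for [diag(M, 1)]. It suffices to contract the loop
    [th |-> E(A(2 th))] of SL_3 to the identity through a homotopy that is C^1
    in time: the concatenation of its translates under the rotation by
    [alpha / 2] is then generated by a continuous map on the mapping torus.

    Products and conjugates of contractible loops are contractible, and so is
    [E(M)] for a loop [M] in SL_2 of trace [> -2]. First,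
    [A(2 th) = F(th) A(th) A(0)^-1 A(th)], where [F] is homotopic to 1 through
    continuous loops in SL_2, hence is a product of loops close to 1. Second,
    let [g = diag(1, -1, -1)] and [h = diag(1, -1)], so that
    [g E(A) g = E(h A h)]; for every [C],
    [E(A C A) = E(A h A h) . g . (E(A)^-1 . g E(C) . E(A))].
    The trace of [A h A h] is [(a - d)^2 + 2], and [g] and [E(C)] are constant
    loops. The passage from SL_2 to SL_3 is needed for [g] to be joined to 1. *)

(** * Entrywise continuity and differentiation of matrix-valued maps *)

Section MatrixCalculus.
Variable R : realType.

Lemma continuous_mx (T : topologicalType) m n (F : T -> 'M[R]_(m, n)) :
  (forall i j, continuous (fun x => F x i j)) -> continuous F.
Proof.
move=> cF x U [P FP sPU].
have : \forall y \near x, forall i j, P i j (F y i j).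
  by apply: filter_forall => i; apply: filter_forall => j; apply: cF; exact: FP.
by apply: filterS => y Py; apply: sPU.
Qed.

Lemma continuous_entry (T : topologicalType) m n (F : T -> 'M[R]_(m, n)) i j :
  continuous F -> continuous (fun x => F x i j).
Proof.
move=> cF x; apply: (@continuous_comp _ _ _ F (fun M : 'M[R]_(m, n) => M i j)).
  exact: cF.
exact: coord_continuous.
Qed.

Lemma continuous_sum (T : topologicalType) (I : finType) (f : I -> T -> R) :
  (forall i, continuous (f i)) -> continuous (fun x => \sum_i f i x).
Proof.
move=> cf; apply: continuous_big => //.
exact: add_continuous.
Qed.

Lemma continuous_mulmx (T : topologicalType) m n p
    (F : T -> 'M[R]_(m, n)) (G : T -> 'M[R]_(n, p)) :
  continuous F -> continuous G -> continuous (fun x => F x *m G x).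
Proof.
move=> cF cG; apply: continuous_mx => i j.
under eq_fun do rewrite mxE.
apply: continuous_sum => k x.
by apply: continuousM; exact: continuous_entry.
Qed.

Lemma continuous_addmx (T : topologicalType) m n (F G : T -> 'M[R]_(m, n)) :
  continuous F -> continuous G -> continuous (fun x => F x + G x).
Proof. by move=> cF cG x; apply: cvgD; [exact: cF|exact: cG]. Qed.

Lemma continuous_mxtrace (T : topologicalType) n (F : T -> 'M[R]_n) :
  continuous F -> continuous (fun x => \tr (F x)).
Proof. by move=> cF; apply: continuous_sum => k; exact: continuous_entry. Qed.

Lemma is_derive_mx m n (F : R -> 'M[R]_(m, n)) (dF : 'M[R]_(m, n)) (t : R) :
  (forall i j, is_derive t 1 (fun r => F r i j) (dF i j)) ->
  is_derive t 1 F dF.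
Proof.
move=> dFE.
have FD : derivable F t 1 by apply/derivable_mxP => i j; case: (dFE i j).
apply: DeriveDef => //; rewrite derive_mx//; apply/matrixP => i j.
by rewrite mxE; case: (dFE i j).
Qed.

Lemma is_derive_entry m n (F : R -> 'M[R]_(m, n)) (dF : 'M[R]_(m, n)) (t : R)
    i j :
  is_derive t 1 F dF -> is_derive t 1 (fun r => F r i j) (dF i j).
Proof.
case=> FD <-; apply: DeriveDef; first by move/derivable_mxP : FD; exact.
by rewrite derive_mx// mxE.
Qed.

Lemma is_derive_mulmx m n p (F : R -> 'M[R]_(m, n)) (G : R -> 'M[R]_(n, p))
    dF dG (t : R) :
  is_derive t 1 F dF -> is_derive t 1 G dG ->
  is_derive t 1 (fun r => F r *m G r) (dF *m G t + F t *m dG).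
Proof.
move=> dFE dGE; apply: is_derive_mx => i j.
rewrite [X in is_derive _ _ X _](_ : _ =
    \sum_k (fun r => F r i k) * (fun r => G r k j)); last first.
  by apply/funext => r; rewrite mxE fct_sumE.
rewrite !mxE -big_split/=.
apply: is_derive_sum => k.
have Fik := is_derive_entry i k dFE.
have Gkj := is_derive_entry k j dGE.
apply: (is_derive_eq (is_deriveM Fik Gkj)).
by rewrite addrC; congr (_ + _); exact: mulrC.
Qed.

Lemma is_derive_mx_shift m n (F : R -> 'M[R]_(m, n)) dF (c t : R) :
  is_derive (t + c) 1 F dF -> is_derive t 1 (fun r => F (r + c)) dF.
Proof.
move=> hF; apply: is_derive_mx => i j.
have h1 : is_derive t 1 (fun r : R => r + c) 1.
  rewrite -[1 in X in is_derive _ _ _ X]addr0.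
  exact: (is_deriveD (is_derive_id t 1) (is_derive_cst c t 1)).
have := @is_derive1_comp _ (fun r => F r i j) (fun r => r + c) t _ _
  (is_derive_entry i j hF) h1.
by rewrite mulr1.
Qed.

End MatrixCalculus.

(** * Products and conjugates of contractible loops *)

Section Contractible.
Variables (R : realType) (d : nat).
Implicit Types M N P Q : circle R -> 'M[R]_d.

(* [K] is the inverse of the homotopy [H]. The conditions for [r <= 0] and
   [1 <= r] let consecutive homotopies be concatenated as a product. *)
Definition contractible M : Prop :=
  exists H K G : circle R * R -> 'M[R]_d,
  [/\ [/\ continuous H, continuous K & continuous G],
      forall p, K p *m H p = 1%:M,
      forall th (r : R),
        is_derive r 1 (fun r => H (th, r)) (G (th, r) *m H (th, r)),
      forall p, \det (H p) = 1 /\ \tr (G p) = 0 &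
      forall th r,
        (r <= 0 -> H (th, r) = 1%:M /\ G (th, r) = 0) /\
        (1 <= r -> H (th, r) = M th /\ G (th, r) = 0)].

(** Since [K1] inverts [H1], the derivative of [H1 H2] is [(G1 + H1 G2 K1) H1 H2]; the second
    summand is conjugate to [G2], hence has trace zero. *)
Lemma contractibleM M N : contractible M -> contractible N ->
  contractible (fun th => M th *m N th).
Proof.
move=> [H1 [K1 [G1 [[cH1 cK1 cG1] KH1 dH1 tr1 H1E]]]].
move=> [H2 [K2 [G2 [[cH2 cK2 cG2] KH2 dH2 tr2 H2E]]]].
exists (fun p => H1 p *m H2 p), (fun p => K2 p *m K1 p),
  (fun p => G1 p + H1 p *m G2 p *m K1 p); split.
- split; try exact: continuous_mulmx.
  apply: continuous_addmx => //.
  by apply: continuous_mulmx => //; exact: continuous_mulmx.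
- by move=> p; rewrite mulmxA -(mulmxA (K2 p)) KH1 mulmx1 KH2.
- move=> th r; apply: (is_derive_eq (is_derive_mulmx (dH1 th r) (dH2 th r))).
  by rewrite mulmxDl mulmxA -!mulmxA (mulmxA (K1 _)) KH1 mul1mx.
- move=> p; have [d1 t1] := tr1 p; have [d2 t2] := tr2 p.
  rewrite det_mulmx d1 d2 mulr1; split=> //.
  by rewrite mxtraceD t1 add0r mxtrace_mulC mulmxA KH1 mul1mx.
- move=> th r; have [E10 E11] := H1E th r; have [E20 E21] := H2E th r.
  split=> r0.
    have [-> ->] := E10 r0; have [-> ->] := E20 r0.
    by rewrite mulmx1 mulmx0 mul0mx addr0.
  have [-> ->] := E11 r0; have [-> ->] := E21 r0.
  by rewrite mulmx0 mul0mx addr0.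
Qed.

(** [P] and [Q] do not depend on time, so the homotopy, its inverse and its generator are conjugated
    pointwise. A permutation matrix of determinant -1 is an admissible [P]. *)
Lemma contractibleJ M P Q : continuous P -> continuous Q ->
    (forall th, Q th *m P th = 1%:M) -> contractible M ->
  contractible (fun th => P th *m M th *m Q th).
Proof.
move=> cP cQ QP [H [K [G [[cH cK cG] KH dH tr HE]]]].
have PQ th : P th *m Q th = 1%:M by exact: mulmx1C.
have cP1 : continuous (fun p : circle R * R => P p.1).
  by move=> p; apply: continuous_comp; [exact: cvg_fst|exact: cP].
have cQ1 : continuous (fun p : circle R * R => Q p.1).
  by move=> p; apply: continuous_comp; [exact: cvg_fst|exact: cQ].
have cJ (F : circle R * R -> 'M[R]_d) : continuous F ->
    continuous (fun p => P p.1 *m F p *m Q p.1).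
  by move=> cF; apply: continuous_mulmx => //; exact: continuous_mulmx.
have JM (X Y : 'M[R]_d) th :
    P th *m X *m Q th *m (P th *m Y *m Q th) = P th *m (X *m Y) *m Q th.
  by rewrite -!mulmxA (mulmxA (Q th) (P th)) QP mul1mx.
exists (fun p => P p.1 *m H p *m Q p.1), (fun p => P p.1 *m K p *m Q p.1),
  (fun p => P p.1 *m G p *m Q p.1); split.
- by split; exact: cJ.
- by move=> p; rewrite JM KH mulmx1 PQ.
- move=> th r /=; rewrite JM.
  have dP := is_derive_mulmx (is_derive_cst (P th) r 1) (dH th r).
  apply: (is_derive_eq (is_derive_mulmx dP (is_derive_cst (Q th) r 1))).
  by rewrite mul0mx add0r mulmx0 addr0.
- move=> p; have [d1 t1] := tr p; split.
    by rewrite !det_mulmx mulrAC -det_mulmx PQ det1 mul1r d1.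
  by rewrite mxtrace_mulC mulmxA QP mul1mx.
- move=> th r; have [E0 E1] := HE th r; split=> r0 /=.
    have [-> ->] := E0 r0.
    by rewrite mulmx1 mulmx0 mul0mx PQ.
  have [-> ->] := E1 r0.
  by rewrite mulmx0 mul0mx.
Qed.

End Contractible.

(** * A C^1 transition function from 0 to 1 *)

Section Step.
Variable R : realType.
Implicit Types r : R.

(** Squaring makes the positive part C^1 at 0, with derivative zero there. *)
Definition sqpos r : R := (Num.max r 0) ^+ 2.

Lemma is_derive_sqpos r : is_derive r 1 sqpos (2 * Num.max r 0).
Proof.
have [r0|r0|->] := ltgtP r 0.
- rewrite mulr0.
  apply: (@near_eq_is_derive _ _ _ (cst 0)).
  near=> x; rewrite /sqpos max_r ?expr0n//.
  by apply: ltW; near: x; exact: lt_nbhsl.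
- apply: (@near_eq_is_derive _ _ _ (fun x : R => x ^+ 2)).
    near=> x; rewrite /sqpos max_l//.
    by apply: ltW; near: x; exact: lt_nbhsr.
  apply: (is_derive_eq (is_deriveX 2 (is_derive_id r 1))).
  by rewrite /GRing.scale/= mulr1 expr1.
- rewrite mulr0.
  suff H : h^-1 *: (sqpos (h *: 1 + 0) - sqpos 0) @[h --> 0^'] --> (0 : R).
    by apply: DeriveDef; [apply/cvg_ex; exists 0|exact/cvg_lim].
  (* For nonzero [h] the difference quotient of [sqpos] at 0 is exactly [max(h, 0)], which tends to
     0. *)
  apply: (@cvg_trans _ ((Num.max (h : R) 0 : R) @[h --> (0 : R)^'])).
    apply: near_eq_cvg; near=> h.
    have h0 : h != 0 by near: h; exact: nbhs_dnbhs_neq.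
    rewrite /sqpos maxxx expr0n subr0 addr0 /GRing.scale/= mulr1.
    by case: (leP h 0) => _; [rewrite expr0n mulr0|rewrite expr2 mulKf].
  have c0 : {for (0 : R), continuous (id \max cst (0 : R))}.
    by apply: continuous_max; [exact: cvg_id|exact: cvg_cst].
  apply: cvg_within_filter; move: c0.
  by rewrite /prop_for /continuous_at /= maxxx.
Unshelve. all: by end_near. Qed.

Definition step_den r : R := sqpos r + sqpos (1 - r).

(** [r] and [1 - r] cannot both be nonpositive. *)
Lemma step_den_gt0 r : 0 < step_den r.
Proof.
rewrite /step_den /sqpos; have [r0|r0] := leP r 0.
  rewrite max_l ?subr_ge0 ?(le_trans r0)//; nra.
by rewrite ltr_wpDr ?sqr_ge0// exprn_gt0.
Qed.

Definition step r : R := sqpos r / step_den r.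

(** With [u = max(r, 0)] and [v = max(1 - r, 0)], the quotient rule for [u^2 / (u^2 + v^2)]
    simplifies to this; the factor [u v] makes it vanish outside []0, 1[]. *)
Definition dstep r : R :=
  2 * Num.max r 0 * Num.max (1 - r) 0 * (Num.max r 0 + Num.max (1 - r) 0) /
  step_den r ^+ 2.

Lemma step_le0 r : r <= 0 -> step r = 0 /\ dstep r = 0.
Proof.
move=> r0; rewrite /step /dstep /sqpos max_r//.
by rewrite expr0n mulr0 !mul0r.
Qed.

Lemma step_ge1 r : 1 <= r -> step r = 1 /\ dstep r = 0.
Proof.
move=> r1; have E : Num.max (1 - r) 0 = 0 by rewrite max_r ?subr_le0.
rewrite /dstep E mulr0 !mul0r; split=> //.
rewrite /step /step_den /sqpos E expr0n addr0 divff//.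
by rewrite expf_neq0// max_l ?(le_trans ler01)// gt_eqF// (lt_le_trans ltr01).
Qed.

Lemma step_ge0 r : 0 <= step r.
Proof. by rewrite divr_ge0 ?sqr_ge0// ltW// step_den_gt0. Qed.

Lemma step_le1 r : step r <= 1.
Proof. by rewrite ler_pdivrMr ?step_den_gt0// mul1r lerDl sqr_ge0. Qed.

Lemma is_derive_step r : is_derive r 1 step (dstep r).
Proof.
have D0 : step_den r != 0 by rewrite gt_eqF// step_den_gt0.
have d1r : is_derive r 1 (fun x : R => 1 - x) (-1).
  rewrite -[- 1]sub0r.
  exact: (is_deriveB (is_derive_cst (1 : R) r 1) (is_derive_id r 1)).
have dv := @is_derive1_comp _ sqpos (fun x => 1 - x) r _ _
  (is_derive_sqpos (1 - r)) d1r.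
have dD : is_derive r 1 step_den _ := is_deriveD (is_derive_sqpos r) dv.
apply: (is_derive_eq (is_deriveM (is_derive_sqpos r) (is_deriveV D0 dD))).
rewrite /dstep /GRing.scale/=; move: D0; rewrite /step_den /sqpos.
set u := Num.max r 0; set v := Num.max (1 - r) 0 => D0.
by field.
Qed.

Lemma continuous_maxr0 (f : R -> R) : continuous f ->
  continuous (fun r => Num.max (f r) 0).
Proof.
move=> cf r.
have := @continuous_max _ _ f (cst 0) r (cf r) (@cvg_cst _ _ _ _ _).
exact.
Qed.

Lemma continuous_step : continuous step.
Proof.
move=> r; apply/differentiable_continuous/derivable1_diffP.
by case: (is_derive_step r).
Qed.

Lemma continuous_dstep : continuous dstep.
Proof.
have c1 : continuous (fun r => Num.max r 0 : R).
  by apply: (@continuous_maxr0 id) => r; exact: cvg_id.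
have c2 : continuous (fun r => Num.max (1 - r) 0 : R).
  apply: (@continuous_maxr0 (fun r => 1 - r)) => r.
  by apply: cvgB; [exact: cvg_cst|exact: cvg_id].
move=> r; rewrite /dstep; apply: cvgM.
  apply: cvgM; last by apply: cvgD; [exact: c1|exact: c2].
  apply: cvgM; last exact: c2.
  by apply: cvgM; [exact: cvg_cst|exact: c1].
apply: cvgV; first by rewrite expf_neq0// gt_eqF// step_den_gt0.
rewrite /step_den /sqpos.
have c1r := c1 r; have c2r := c2 r.
by apply: cvgM; apply: cvgD; apply: cvgM.
Qed.

End Step.

(** * Block matrices [diag(M, x)] and identities for 2 by 2 matrices *)

Section BlockDiag.
Variable R : realType.
Implicit Types (M N : 'M[R]_2) (x y : R).

(** [E(M)] is [diag21 M 1]; other values of [x] occur along homotopies and in their generators. *)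
Definition diag21 M x : 'M[R]_3 := block_mx M 0 0 (x%:M : 'M[R]_1).

Lemma diag21M M N x y : diag21 M x *m diag21 N y = diag21 (M *m N) (x * y).
Proof.
rewrite /diag21 (mulmx_block M 0 0 (x%:M : 'M[R]_1) N 0 0 (y%:M : 'M[R]_1)).
by rewrite !mul0mx !mulmx0 !addr0 !add0r -scalar_mxM.
Qed.

Lemma mul_diag21_col M x (v : 'cV[R]_2) (w : 'cV[R]_1) :
  diag21 M x *m (col_mx v w : 'cV[R]_3) = col_mx (M *m v) (x *: w).
Proof.
rewrite /diag21 (mul_block_col M 0 0 (x%:M : 'M[R]_1) v w).
by rewrite !mul0mx addr0 add0r mul_scalar_mx.
Qed.

Lemma diag21_1 : diag21 1%:M 1 = 1%:M.
Proof. by rewrite /diag21 -scalar_mx_block. Qed.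

Lemma det_diag21 M x : \det (diag21 M x) = \det M * x.
Proof. by rewrite /diag21 (det_ublock M 0 (x%:M : 'M[R]_1)) det_scalar1. Qed.

Lemma tr_diag21 M x : \tr (diag21 M x) = \tr M + x.
Proof.
by rewrite /diag21 (mxtrace_block M 0 0 (x%:M : 'M[R]_1)) mxtrace_scalar mulr1n.
Qed.

Lemma diag21_ul M x (i j : 'I_2) : diag21 M x (lshift 1 i) (lshift 1 j) = M i j.
Proof. exact: (block_mxEul M 0 0 (x%:M : 'M[R]_1)). Qed.

Lemma diag21_ur M x (i : 'I_2) (j : 'I_1) :
  diag21 M x (lshift 1 i) (rshift 2 j) = 0.
Proof. by rewrite /diag21 (block_mxEur M 0 0 (x%:M : 'M[R]_1)) mxE. Qed.

Lemma diag21_dl M x (i : 'I_1) (j : 'I_2) :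
  diag21 M x (rshift 2 i) (lshift 1 j) = 0.
Proof. by rewrite /diag21 (block_mxEdl M 0 0 (x%:M : 'M[R]_1)) mxE. Qed.

Lemma diag21_dr M x (i j : 'I_1) : diag21 M x (rshift 2 i) (rshift 2 j) = x.
Proof.
by rewrite /diag21 (block_mxEdr M 0 0 (x%:M : 'M[R]_1)) mxE (ord1 i) (ord1 j).
Qed.

Definition diag21E := (diag21_ul, diag21_ur, diag21_dl, diag21_dr).

Lemma continuous_diag21 (T : topologicalType) (F : T -> 'M[R]_2) (f : T -> R) :
  continuous F -> continuous f -> continuous (fun t => diag21 (F t) (f t)).
Proof.
move=> cF cf; apply: continuous_mx => i j.
case: (@split_ordP 2 1 i) => k ->; case: (@split_ordP 2 1 j) => l ->.
- under eq_fun do rewrite diag21E.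
  exact: continuous_entry.
- by under eq_fun do rewrite diag21E; exact: cst_continuous.
- by under eq_fun do rewrite diag21E; exact: cst_continuous.
- by under eq_fun do rewrite diag21E; exact: cf.
Qed.

Lemma is_derive_diag21 (F : R -> 'M[R]_2) (f : R -> R) dF df (t : R) :
  is_derive t 1 F dF -> is_derive t 1 f df ->
  is_derive t 1 (fun r => diag21 (F r) (f r)) (diag21 dF df).
Proof.
move=> hF hf; apply: is_derive_mx => i j.
case: (@split_ordP 2 1 i) => k ->; case: (@split_ordP 2 1 j) => l ->.
- rewrite diag21E; under eq_fun do rewrite diag21E.
  exact: is_derive_entry.
- by rewrite diag21E; under eq_fun do rewrite diag21E; exact: is_derive_cst.
- by rewrite diag21E; under eq_fun do rewrite diag21E; exact: is_derive_cst.
- by rewrite diag21E; under eq_fun do rewrite diag21E; exact: hf.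
Qed.

(* The adjugate, in a form that is visibly affine in [M]. *)
Definition adj2 M : 'M[R]_2 := (\tr M)%:M - M.

Lemma det2 M : \det M = M 0 0 * M 1 1 - M 0 1 * M 1 0.
Proof.
rewrite (expand_det_row _ ord0) !big_ord_recl big_ord0 /cofactor !det_mx11 !mxE.
have E0 : lift (ord0 : 'I_2) (ord0 : 'I_1) = 1 by exact: val_inj.
have E1 : lift (1 : 'I_2) (ord0 : 'I_1) = 0 by exact: val_inj.
by rewrite !E0 ?E1 /=; ring.
Qed.

Lemma tr2 M : \tr M = M 0 0 + M 1 1.
Proof.
rewrite /mxtrace !big_ord_recl big_ord0 addr0.
by congr (_ + M _ _); exact: val_inj.
Qed.

Lemma matrix2P M N : M 0 0 = N 0 0 -> M 0 1 = N 0 1 -> M 1 0 = N 1 0 ->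
  M 1 1 = N 1 1 -> M = N.
Proof.
move=> h00 h01 h10 h11; apply/matrixP => i j.
have : (i == 0) || (i == 1) by case: i => [[|[|?]] ?].
have : (j == 0) || (j == 1) by case: j => [[|[|?]] ?].
by move=> /orP[] /eqP-> /orP[] /eqP->.
Qed.

Lemma mulmx2E M N i j : (M *m N) i j = M i 0 * N 0 j + M i 1 * N 1 j.
Proof.
rewrite mxE !big_ord_recl big_ord0 addr0.
by congr (_ + M _ _ * N _ _); exact: val_inj.
Qed.

Lemma mul_adj2 M : adj2 M *m M = (\det M)%:M.
Proof.
by apply: matrix2P; rewrite mulmx2E !mxE det2 tr2 /=; ring.
Qed.

Lemma det_adj2 M : \det (adj2 M) = \det M.
Proof. by rewrite !det2 !mxE tr2 /=; ring. Qed.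

Lemma mul_mx_adj2 M : M *m adj2 M = (\det M)%:M.
Proof. by rewrite -mul_adj2 mulmxBr mulmxBl mul_mx_scalar mul_scalar_mx. Qed.

Lemma continuous_adj2 (T : topologicalType) (F : T -> 'M[R]_2) :
  continuous F -> continuous (fun t => adj2 (F t)).
Proof.
move=> cF; apply: continuous_mx => i j.
have -> : (fun t => adj2 (F t) i j) =
    fun t => \tr (F t) *+ (i == j) - F t i j.
  by apply/funext => t; rewrite !mxE.
move=> t; apply: cvgB; last exact: continuous_entry.
case: (i == j) => /=; last by rewrite mulr0n; exact: cvg_cst.
exact: continuous_mxtrace.
Qed.

End BlockDiag.


(** * Contractibility of loops of trace greater than -2 *)

Section TraceCriterion.
Variable R : realType.
Implicit Types M : circle R -> 'M[R]_2.

Lemma is_derive_affine m n (f : R -> R) df (X Y : 'M[R]_(m, n)) (t : R) :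
  is_derive t 1 f df -> is_derive t 1 (fun r => X + f r *: Y) (df *: Y).
Proof.
move=> hf; apply: is_derive_mx => i j.
rewrite [X in is_derive _ _ X _](_ : _ = cst (X i j) + Y i j \*: f); last first.
  by apply/funext => r; rewrite !mxE mulrC.
apply: (is_derive_eq (is_deriveD (is_derive_cst _ _ _) (is_deriveZ _ hf))).
by rewrite add0r mxE mulrC.
Qed.

Lemma det2_segment (X : 'M[R]_2) (s : R) :
  \det (1%:M + s *: (X - 1%:M)) =
  1 + s * (1 - s) * (\tr X - 2) + s ^+ 2 * (\det X - 1).
Proof.
rewrite !det2 tr2 !mxE /= ?mulr1n ?mulr0n.
by move: (X 0 0) (X 0 1) (X 1 0) (X 1 1) => a b c d; ring.
Qed.

(** By Jacobi's formula this trace is the derivative in [s] of the determinant in [det2_segment]. *)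
Lemma mxtrace_segment (X : 'M[R]_2) (s : R) :
  \tr ((X - 1%:M) *m adj2 (1%:M + s *: (X - 1%:M))) =
  (1 - 2 * s) * (\tr X - 2) + 2 * s * (\det X - 1).
Proof.
rewrite (tr2 (_ *m _)) !mulmx2E /adj2 !mxE !tr2 !det2 !mxE /= ?mulr1n ?mulr0n.
by move: (X 0 0) (X 0 1) (X 1 0) (X 1 1) => a b c d; ring.
Qed.

(* A matrix of SL_2 with trace > -2 is joined to 1 by a segment of invertible
   matrices; the last coordinate absorbs the determinant [D]. *)
Lemma contractible_trace M : continuous M -> (forall th, \det (M th) = 1) ->
  (forall th, - 2 < \tr (M th)) -> contractible (fun th => diag21 (M th) 1).
Proof.
move=> cM dM tM.
pose D (p : circle R * R) : R :=
  1 + step p.2 * (1 - step p.2) * (\tr (M p.1) - 2).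
pose N (p : circle R * R) : 'M[R]_2 := M p.1 - 1%:M.
pose P (p : circle R * R) : 'M[R]_2 := 1%:M + step p.2 *: N p.
pose dD (p : circle R * R) : R :=
  dstep p.2 * (1 - 2 * step p.2) * (\tr (M p.1) - 2).
have D_gt0 p : 0 < D p.
  have h : 0 <= step p.2 * (1 - step p.2).
    by rewrite mulr_ge0 ?step_ge0// subr_ge0 step_le1.
  have [e|e] := eqVneq (step p.2 * (1 - step p.2)) 0.
    by rewrite /D e mul0r addr0 ltr01.
  have h1 : 0 < step p.2 * (1 - step p.2) * (\tr (M p.1) + 2).
    by rewrite mulr_gt0// ?lt0r ?e//; have := tM p.1; lra.
  (* With [s] the step and [t] the trace, [D = (1 - 2 s)^2 + s (1 - s) (t + 2)]: a square plus the
     quantity made positive by [h1]. *)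
  have := sqr_ge0 (1 - 2 * step p.2); rewrite /D.
  by move: h1; set s := step _; set t := \tr _ => *; nra.
have D0 p : D p != 0 by rewrite gt_eqF.
have detP p : \det (P p) = D p.
  by rewrite det2_segment dM subrr mulr0 addr0.
have trN p : \tr (N p *m adj2 (P p)) = (1 - 2 * step p.2) * (\tr (M p.1) - 2).
  by rewrite mxtrace_segment dM subrr mulr0 addr0.
have cstep : continuous (fun p : circle R * R => step p.2).
  by move=> p; apply: continuous_comp; [exact: cvg_snd|exact: continuous_step].
have cdstep : continuous (fun p : circle R * R => dstep p.2).
  by move=> p; apply: continuous_comp; [exact: cvg_snd|exact: continuous_dstep].
have cM1 : continuous (fun p : circle R * R => M p.1).
  by move=> p; apply: continuous_comp; [exact: cvg_fst|exact: cM].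
have ctr := continuous_mxtrace cM1.
have cN : continuous N.
  by move=> p; apply: cvgB; [exact: cM1|exact: cvg_cst].
have cP : continuous P.
  move=> p; apply: cvgD; first exact: cvg_cst.
  by apply: cvgZ; [exact: cstep|exact: cN].
have cD : continuous D.
  move=> p; apply: cvgD; first exact: cvg_cst.
  apply: cvgM; last by apply: cvgB; [exact: ctr|exact: cvg_cst].
  apply: cvgM; first exact: cstep.
  by apply: cvgB; [exact: cvg_cst|exact: cstep].
have cDV : continuous (fun p => (D p)^-1).
  by move=> p; apply: cvgV; [exact: D0|exact: cD].
have cdD : continuous dD.
  move=> p; apply: cvgM; last by apply: cvgB; [exact: ctr|exact: cvg_cst].
  apply: cvgM; first exact: cdstep.
  apply: cvgB; first exact: cvg_cst.
  by apply: cvgM; [exact: cvg_cst|exact: cstep].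
have cQ : continuous (fun p => (D p)^-1 *: adj2 (P p)).
  by move=> p; apply: cvgZ; [exact: cDV|exact: continuous_adj2].
have QP p : (D p)^-1 *: adj2 (P p) *m P p = 1%:M.
  by rewrite -scalemxAl mul_adj2 detP scale_scalar_mx mulVf.
(* [D^-1 adj(P)] inverts [P], and the block of the generator is [P' P^-1]. Its trace is [dD / D],
   which the logarithmic derivative of the last entry [D^-1] cancels. *)
exists (fun p => diag21 (P p) (D p)^-1),
  (fun p => diag21 ((D p)^-1 *: adj2 (P p)) (D p)),
  (fun p => diag21 (dstep p.2 *: (N p *m ((D p)^-1 *: adj2 (P p))))
                   (- (dD p / D p))); split.
- split.
  + exact: (continuous_diag21 cP cDV).
  + exact: (continuous_diag21 cQ cD).
  + apply: continuous_diag21.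
      move=> p; apply: cvgZ; first exact: cdstep.
      exact: (continuous_mulmx cN cQ).
    by move=> p; apply: cvgN; apply: cvgM; [exact: cdD|exact: cDV].
- by move=> p; rewrite diag21M QP mulfV// diag21_1.
- move=> th r /=; rewrite diag21M -scalemxAl -mulmxA QP mulmx1.
  apply: is_derive_diag21.
    exact: (is_derive_affine 1%:M (N (th, r)) (is_derive_step r)).
  have ds := is_derive_step r.
  have dD' : is_derive r 1 (fun r => D (th, r)) (dD (th, r)).
    have dc := is_derive_cst (\tr (M th) - 2) r 1.
    have d1 := is_deriveB (is_derive_cst (1 : R) r 1) ds.
    have d2 := is_deriveM (is_deriveM ds d1) dc.
    apply: (is_derive_eq (is_deriveD (is_derive_cst (1 : R) r 1) d2)).
    rewrite /dD /GRing.scale /= mulr0.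
    by rewrite (_ : (cst 1 - @step R) r = 1 - step r)//; ring.
  have dV := @is_deriveV _ (fun r => D (th, r)) r _ 1 (D0 (th, r)) dD'.
  apply: (is_derive_eq dV).
  by rewrite /GRing.scale /=; field.
- move=> p; rewrite det_diag21 detP mulfV//; split=> //.
  rewrite tr_diag21 mxtraceZ -scalemxAr mxtraceZ trN /dD.
  by field.
- move=> th r; split=> r0.
    have [s0 ds0] := step_le0 r0.
    rewrite /P /D /dD /= s0 ds0 !scale0r !mul0r !addr0 invr1 diag21_1.
    split=> //.
    by rewrite oppr0 /diag21 raddf0 block_mx0.
  have [s0 ds0] := step_ge1 r0.
  rewrite /P /D /dD /= s0 ds0 subrr mulr0 !scale0r scale1r !mul0r.
  rewrite !addr0 invr1; split=> //.
    by rewrite /N addrC subrK.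
  by rewrite oppr0 /diag21 raddf0 block_mx0.
Qed.

End TraceCriterion.

(** * Constant loops, half turns and loops of the form [A C A] *)

Section Generators.
Variable R : realType.
Implicit Types C M N : 'M[R]_2.

Definition quarter_turn : 'M[R]_2 := delta_mx 1 0 - delta_mx 0 1.

Lemma quarter_turn_sqr : quarter_turn *m quarter_turn = - 1%:M.
Proof. by apply: matrix2P; rewrite mulmx2E !mxE /= ?mulr1n ?mulr0n; ring. Qed.

(** If the trace is at most -2, then [C = (- C) Q Q] with [Q] the quarter turn, of trace 0, and
    [- C] of trace at least 2. *)
Lemma contractible_cst C : \det C = 1 ->
  contractible (fun _ : circle R => diag21 C 1).
Proof.
move=> dC; have [trC|trC] := ltP (- 2) (\tr C).
  by apply: contractible_trace => //; exact: cst_continuous.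
have cQ : contractible (fun _ : circle R => diag21 quarter_turn 1).
  apply: contractible_trace => [|_|_]; first exact: cst_continuous.
  - by rewrite det2 !mxE /= ?mulr1n ?mulr0n; ring.
  - by rewrite tr2 !mxE /= ?mulr1n ?mulr0n; lra.
have cN : contractible (fun _ : circle R => diag21 (- C) 1).
  apply: contractible_trace => [|_|_]; first exact: cst_continuous.
  - by rewrite -dC !det2 !mxE; ring.
  - by rewrite raddfN /=; lra.
have := contractibleM cN (contractibleM cQ cQ).
by rewrite !diag21M !mulr1 quarter_turn_sqr mulNmx mulmxN opprK mulmx1.
Qed.

Definition half_turn_sign n (i : 'I_n) : R :=
  if i == 0%N :> nat then 1 else - 1.

(** One definition covers both [g] (size 3) and [h] (size 2); only the first is a rotation. *)
Definition half_turn n : 'M[R]_n := diag_mx (\row_i half_turn_sign i).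

Lemma half_turnE n (X : 'M[R]_n) i j :
  (half_turn n *m X *m half_turn n) i j =
  half_turn_sign i * X i j * half_turn_sign j.
Proof. by rewrite mul_mx_diag mxE mul_diag_mx !mxE. Qed.

Lemma half_turn_sqr n : half_turn n *m half_turn n = 1%:M.
Proof.
apply/matrixP => i j; rewrite mul_diag_mx !mxE; case: eqVneq => [->|].
  by rewrite /half_turn_sign; case: ifP; rewrite !mulr1n; lra.
by rewrite !mulr0n mulr0.
Qed.

Lemma half_turn_diag21 M x :
  half_turn 3 *m diag21 M x *m half_turn 3 =
  diag21 (half_turn 2 *m M *m half_turn 2) x.
Proof.
apply/matrixP => i j; rewrite half_turnE.
case: (@split_ordP 2 1 i) => k ->; case: (@split_ordP 2 1 j) => l ->.
- by rewrite !diag21E half_turnE.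
- by rewrite !diag21E mulr0 mul0r.
- by rewrite !diag21E mulr0 mul0r.
- by rewrite !diag21E /half_turn_sign /=; lra.
Qed.

(** Exchanging the first and last coordinates conjugates [E(-1) = diag(-1, -1, 1)] into [g], and
    [E(-1)] is a constant loop from SL_2. *)
Lemma contractible_half_turn : contractible (fun _ : circle R => half_turn 3).
Proof.
have dN1 : \det (- 1%:M : 'M[R]_2) = 1 by rewrite det2 !mxE /=; lra.
pose T : 'M[R]_3 := tperm_mx ord0 ord_max.
have TT : T *m T = 1%:M by rewrite -perm_mxM tperm2 perm_mx1.
have cT : continuous (fun _ : circle R => T) by exact: cst_continuous.
have := contractibleJ cT cT (fun _ => TT) (contractible_cst dN1).
congr contractible; apply/funext => _.
(* [E(-1)] is written as a diagonal matrix with its entry 1 at the last index; the transposition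
   moves that entry to the first. *)
have E k l : diag21 (- 1%:M) 1 k l =
    (if k == ord_max then 1 else - 1) *+ (k == l) :> R.
  case: (@split_ordP 2 1 k) => k' ->; case: (@split_ordP 2 1 l) => l' ->.
  - rewrite diag21E !mxE (@eq_lshift 2 1).
    have -> : (lshift 1 k' == ord_max :> 'I_3) = false.
      by apply: negbTE; rewrite neq_ltn /= ltn_ord.
    by rewrite mulNrn.
  - by rewrite diag21E (@eq_lrshift 2 1).
  - by rewrite diag21E (@eq_rlshift 2 1).
  - by rewrite diag21E (@eq_rshift 2 1) (ord1 k') (ord1 l').
rewrite -xcolE -xrowE; apply/matrixP => i j; rewrite 2!mxE E !mxE.
rewrite (inj_eq perm_inj) -[X in _ == X](tpermL ord0 ord_max) (inj_eq perm_inj).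
by [].
Qed.

(** Conjugation by [h] changes the sign of the off-diagonal entries [b], [c], so the trace is
    [a^2 - 2 b c + d^2 = (a - d)^2 + 2 det A]. *)
Lemma contractible_mul_half_turn (A : circle R -> 'M[R]_2) :
  continuous A -> (forall th, \det (A th) = 1) ->
  contractible
    (fun th => diag21 (A th *m (half_turn 2 *m A th *m half_turn 2)) 1).
Proof.
move=> cA dA.
have cH : continuous (fun _ : circle R => half_turn 2) by exact: cst_continuous.
apply: contractible_trace => [|th|th].
- exact: (continuous_mulmx cA (continuous_mulmx (continuous_mulmx cH cA) cH)).
- rewrite !det_mulmx dA !mul1r mulr1 -det_mulmx half_turn_sqr.
  by rewrite det1.
- suff -> : \tr (A th *m (half_turn 2 *m A th *m half_turn 2)) =
      (A th 0 0 - A th 1 1) ^+ 2 + 2 * \det (A th).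
    by rewrite dA; have := sqr_ge0 (A th 0 0 - A th 1 1); lra.
  by rewrite tr2 !(mulmx2E (A th)) !half_turnE det2 /half_turn_sign /=; ring.
Qed.

Lemma contractible_mid (A : circle R -> 'M[R]_2) C :
  continuous A -> (forall th, \det (A th) = 1) -> \det C = 1 ->
  contractible (fun th => diag21 (A th *m C *m A th) 1).
Proof.
move=> cA dA dC.
have cE := continuous_diag21 cA (@cst_continuous _ _ (1 : R)).
have cE' :=
  continuous_diag21 (continuous_adj2 cA) (@cst_continuous _ _ (1 : R)).
have AE th : diag21 (A th) 1 *m diag21 (adj2 (A th)) 1 = 1%:M.
  by rewrite diag21M mul_mx_adj2 dA mulr1 diag21_1.
have cgC := contractibleM contractible_half_turn (contractible_cst dC).
have := contractibleM (contractibleM (contractible_mul_half_turn cA dA)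
  contractible_half_turn) (contractibleJ cE' cE AE cgC).
congr contractible; apply/funext => th.
(* [E(A h A h)] becomes [E(A) g E(A) g]; then [g g], [E(A) E(A)^-1] and again [g g] cancel in turn,
   leaving [E(A) E(C) E(A)]. *)
rewrite -{1}[1]mulr1 -diag21M -half_turn_diag21 -!mulmxA.
rewrite (mulmxA (half_turn 3) (half_turn 3)) half_turn_sqr mul1mx.
rewrite (mulmxA (diag21 (A th) 1) (diag21 _ 1)) AE mul1mx.
rewrite (mulmxA (half_turn 3) (half_turn 3)) half_turn_sqr mul1mx.
by rewrite !diag21M !mulr1.
Qed.

End Generators.

(** * Functions on the circle through representatives in [[0, 1[] *)

Section CircleFunctions.
Variable R : realType.

Lemma continuous_pi_circle : continuous (\pi_(circle R) : R -> circle R).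
Proof. exact/continuousP. Qed.

Lemma circle_continuous (T : topologicalType) (f : circle R -> T) :
  continuous (fun x : R => f (\pi_(circle R) x)) -> continuous f.
Proof. by move=> /continuousP cf; apply/continuousP => U oU; exact: cf. Qed.

Lemma pi_circleD (x y : R) :
  \pi_(circle R) (x + y) = \pi_(circle R) x + \pi_(circle R) y.
Proof. exact: (pi_addr (s := circle R)). Qed.

Lemma pi_circle_eq (x y : R) :
  (\pi_(circle R) x == \pi_(circle R) y) = (x - y \is a Num.int).
Proof.
exact/esym/(@Quotient.idealrBE _
  (GRing.ZmodClosed.clone R (@Num.int_num_subdef R) _)).
Qed.

Lemma pi_circle_int (n : int) : \pi_(circle R) n%:~R = 0.
Proof.
have <- : \pi_(circle R) 0 = 0 by exact: (pi_zeror (s := circle R)).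
apply/eqP; rewrite pi_circle_eq subr0; exact: intr_int.
Qed.

Lemma repr_circle (x : R) :
  exists n : int, repr (\pi_(circle R) x) = x + n%:~R.
Proof.
have : \pi_(circle R) (repr (\pi_(circle R) x)) == \pi_(circle R) x.
  by rewrite reprK.
rewrite pi_circle_eq => /intrP[n e].
by exists n; rewrite -e addrC subrK.
Qed.

Definition fpart (x : R) : R := x - (Num.floor x)%:~R.

Lemma fpart_ge0 x : 0 <= fpart x.
Proof. by rewrite subr_ge0 floor_le_tmp. Qed.

Lemma fpart_lt1 x : fpart x < 1.
Proof. by rewrite ltrBlDl -intrD1 floorD1_gt. Qed.

Lemma fpartDz x (n : int) : fpart (x + n%:~R) = fpart x.
Proof. by rewrite /fpart floorDrz ?intr_int// intrKfloor intrD; ring. Qed.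

Lemma fpart_repr (x : R) : fpart (repr (\pi_(circle R) x)) = fpart x.
Proof. by have [n ->] := repr_circle x; rewrite fpartDz. Qed.

Lemma fpartE x (n : int) : n%:~R <= x < n%:~R + 1 -> fpart x = x - n%:~R.
Proof. by rewrite -intrD1 => /floor_def xn; rewrite /fpart xn. Qed.

Lemma pi_fpart_repr (th : circle R) : \pi_(circle R) (fpart (repr th)) = th.
Proof.
by rewrite /fpart -intrN pi_circleD pi_circle_int addr0 reprK.
Qed.

(** [fpart] jumps at integers. Near [x0], with [k] its floor, the function is nevertheless
    [h (x - k) + h (x - k + 1) - c], because one of the two values of [h] is always [c]. *)
Lemma continuous_circle_lift m n (h : R -> 'M[R]_(m, n)) c : continuous h ->
    (forall x, x <= 0 -> h x = c) -> (forall x, 1 <= x -> h x = c) ->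
  continuous (fun th : circle R => h (fpart (repr th))).
Proof.
move=> ch h0 h1; apply: circle_continuous => x0.
set k := (Num.floor x0)%:~R : R.
(* Across an integer, the constancy of [h] outside [0, 1] glues the two
   branches. *)
have E : {near x0, forall x, h (x - k) + h (x - k + 1) - c =
    h (fpart (repr (\pi_(circle R) x)))}.
  have k1 : x0 \in `]k - 1, k + 1[.
    rewrite in_itv /= -[k + 1]intrD1 floorD1_gt andbT.
    by rewrite ltrBlDr (le_lt_trans (floor_le _))// ltrDl.
  near=> x; rewrite fpart_repr.
  have : x \in `]k - 1, k + 1[ by near: x; exact: near_in_itvoo.
  rewrite in_itv /= => /andP[x1 x2].
  have [kx|xk] := leP k x.
    rewrite (fpartE (n := Num.floor x0)) -/k ?kx//.
    by rewrite (h1 (x - k + 1)) ?addrK//; lra.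
  rewrite (fpartE (n := Num.floor x0 - 1)) intrB -/k ?ltW// ?subrK//.
  have -> : x - (k - 1) = x - k + 1 by ring.
  by rewrite (h0 (x - k)) ?subr_le0 ?ltW// addrAC subrr add0r.
have ck : continuous (fun x => x - k).
  by move=> x; apply: cvgB; [exact: cvg_id|exact: cvg_cst].
apply: cvg_trans; first exact: near_eq_cvg E.
rewrite -(nbhs_singleton E) /=.
apply: cvgB; last exact: cvg_cst.
apply: cvgD.
  by apply: (@continuous_comp _ _ _ (fun x => x - k) h); [exact: ck|exact: ch].
apply: (@continuous_comp _ _ _ (fun x => x - k + 1) h); last exact: ch.
by apply: cvgD; [exact: ck|exact: cvg_cst].
Unshelve. all: by end_near. Qed.

End CircleFunctions.

(** * Comparison of [A(2 th)] with [A(th) A(0)^-1 A(th)] *)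

Section Doubling.
Variables (R : realType) (A : circle R -> 'M[R]_2).
Hypotheses (contA : continuous A) (detA : forall th, \det (A th) = 1).

Let a (x : R) : 'M[R]_2 := A (\pi_(circle R) x).

Let cont_a : continuous a.
Proof.
move=> x; apply: (@continuous_comp _ _ _ (\pi_(circle R) : R -> circle R) A).
  exact: continuous_pi_circle.
exact: contA.
Qed.

Let a0 : a 1 = a 0.
Proof. by rewrite /a (pi_circle_int R 1) (pi_circle_int R 0). Qed.

(** Clamping extends loops from [[0, 1]] to the line as maps constant on either side, as
    [continuous_circle_lift] requires. *)
Definition clip (x : R) : R := Num.min (Num.max x 0) 1.

Lemma clip_le0 x : x <= 0 -> clip x = 0.
Proof. by move=> x0; rewrite /clip max_r// min_l. Qed.

Lemma clip_ge1 x : 1 <= x -> clip x = 1.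
Proof. by move=> x1; rewrite /clip max_l ?(le_trans ler01)// min_r. Qed.

Lemma clip_id x : 0 <= x <= 1 -> clip x = x.
Proof. by move=> /andP[x0 x1]; rewrite /clip max_l// min_l. Qed.

Lemma continuous_clip : continuous clip.
Proof.
move=> x.
have c1 : {for x, continuous (id \max cst (0 : R))}.
  by apply: continuous_max; [exact: cvg_id|exact: cvg_cst].
have := @continuous_min _ _ (id \max cst (0 : R)) (cst 1) x c1
  (@cvg_cst _ _ _ _ _).
exact.
Qed.

(* A homotopy, through loops based at 1, from the constant loop to
   [A (2 th) A(th)^-1 A(0) A(th)^-1]: the loop [A] is run up to time [s], once
   on each half of the circle and twice backwards on the whole circle. *)
Definition unwind (p : R * R) : 'M[R]_2 :=
  a (p.1 * clip (2 * p.2)) *m adj2 (a 0) *m a (p.1 * clip (2 * p.2 - 1)) *m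
  (adj2 (a (p.1 * clip p.2)) *m a 0 *m adj2 (a (p.1 * clip p.2))).

Lemma continuous_unwind : continuous unwind.
Proof.
have c2 (f : R -> R) : continuous f ->
    continuous (fun p : R * R => a (p.1 * clip (f p.2))).
  move=> cf p.
  apply: (@continuous_comp _ _ _ (fun p : R * R => p.1 * clip (f p.2)) a).
    2: exact: cont_a.
  apply: cvgM; first exact: cvg_fst.
  apply: (@continuous_comp _ _ _ (fun p : R * R => f p.2) clip).
    2: exact: continuous_clip.
  by apply: (@continuous_comp _ _ _ snd f); [exact: cvg_snd|exact: cf].
have e1 := c2 id (fun x => cvg_id).
have cm : continuous (fun x : R => 2 * x).
  by move=> x; apply: cvgM; [exact: cvg_cst|exact: cvg_id].
have cm1 : continuous (fun x : R => 2 * x - 1).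
  by move=> x; apply: cvgB; [exact: cm|exact: cvg_cst].
have ca0 : continuous (fun _ : R * R => a 0) by exact: cst_continuous.
have ca0' : continuous (fun _ : R * R => adj2 (a 0)) by exact: cst_continuous.
have l := continuous_mulmx (continuous_mulmx (c2 _ cm) ca0') (c2 _ cm1).
have r := continuous_mulmx (continuous_mulmx (continuous_adj2 e1) ca0)
  (continuous_adj2 e1).
exact: (continuous_mulmx l r).
Qed.

Let aK x : a x *m adj2 (a x) = 1%:M.
Proof. by rewrite mul_mx_adj2 detA. Qed.

Let Ka x : adj2 (a x) *m a x = 1%:M.
Proof. by rewrite mul_adj2 detA. Qed.

Lemma det_unwind p : \det (unwind p) = 1.
Proof. by rewrite /unwind !det_mulmx !det_adj2 !detA !mulr1. Qed.

Lemma unwind_time0 x : unwind (0, x) = 1%:M.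
Proof. by rewrite /unwind /= !mul0r aK mul1mx Ka mul1mx aK. Qed.

Lemma unwind_le0 s x : x <= 0 -> unwind (s, x) = 1%:M.
Proof.
move=> x0; have [h1 h2] : 2 * x <= 0 /\ 2 * x - 1 <= 0 by split; lra.
rewrite /unwind /= (clip_le0 x0) (clip_le0 h1) (clip_le0 h2).
by rewrite !mulr0 aK mul1mx Ka mul1mx aK.
Qed.

(** All parameters have reached [s], so [a(s) a(0)^-1 a(s)] meets its inverse: the loop closes up at
    every time [s], even where [a(s)] differs from [a(0)]. *)
Lemma unwind_ge1 s x : 1 <= x -> unwind (s, x) = 1%:M.
Proof.
move=> x1; have [h1 h2] : 1 <= 2 * x /\ 1 <= 2 * x - 1 by split; lra.
rewrite /unwind /= (clip_ge1 x1) (clip_ge1 h1) (clip_ge1 h2) !mulr1.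
rewrite -!mulmxA (mulmxA (a s) (adj2 (a s))) aK mul1mx.
by rewrite (mulmxA (adj2 (a 0))) Ka mul1mx aK.
Qed.

(** The backward factor cancels [a(x) a(0)^-1 a(x)]. On the first half the remaining factor is
    [a(2 x) a(0)^-1 a(0)]; on the second it is [a(1) a(0)^-1 a(2 x - 1)], and periodicity
    concludes. *)
Lemma unwind_time1 x : 0 <= x <= 1 ->
  unwind (1, x) *m (a x *m adj2 (a 0) *m a x) = a (2 * x).
Proof.
move=> x01; rewrite /unwind /= !mul1r (clip_id x01).
rewrite -!mulmxA (mulmxA (adj2 (a x)) (a x)) Ka mul1mx.
rewrite (mulmxA (a 0)) aK mul1mx Ka mulmx1.
have [h|h] := leP x 2^-1.
  have [h1 h2] : 0 <= 2 * x <= 1 /\ 2 * x - 1 <= 0.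
    by split; [apply/andP; split|]; lra.
  by rewrite (clip_id h1) (clip_le0 h2) Ka mulmx1.
have [h1 h2] : 1 <= 2 * x /\ 0 <= 2 * x - 1 <= 1.
  by split; [|apply/andP; split]; lra.
rewrite (clip_ge1 h1) (clip_id h2) a0 mulmxA aK mul1mx /a pi_circleD.
by rewrite -[- 1]/((-1)%:~R) (pi_circle_int R (-1)) addr0.
Qed.

Definition unwind_circle (s : R) (th : circle R) : 'M[R]_2 :=
  unwind (s, fpart (repr th)).

Lemma continuous_unwind_circle s : continuous (unwind_circle s).
Proof.
apply: (@continuous_circle_lift _ _ _ (fun x => unwind (s, x)) 1%:M).
- move=> x; apply: (@continuous_comp _ _ _ (fun x => (s, x)) unwind).
    2: exact: continuous_unwind.
  exact: (cvg_pair (cvg_cst s) cvg_id).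
- exact: unwind_le0.
- exact: unwind_ge1.
Qed.

Lemma unwind_circle1 th :
  unwind_circle 1 th *m (A th *m adj2 (a 0) *m A th) = A (th *+ 2).
Proof.
have e := pi_fpart_repr th.
have aE : a (fpart (repr th)) = A th by rewrite /a e.
have a2E : a (2 * fpart (repr th)) = A (th *+ 2).
  by rewrite /a mulr_natl !mulr2n pi_circleD e.
rewrite -a2E -aE; apply: unwind_time1.
by rewrite fpart_ge0 ltW// fpart_lt1.
Qed.

(** The trace equals 2 on the diagonal [s' = s]; compactness in [x] and then in [s] makes the bound
    uniform. *)
Lemma unwind_close : exists2 N : nat, (0 < N)%N &
  forall s s' x, 0 <= s <= 1 -> `|s' - s| <= N%:R^-1 -> 0 <= x <= 1 ->
    - 2 < \tr (unwind (s', x) *m adj2 (unwind (s, x))).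
Proof.
pose K (q : R * (R * R)) : R :=
  \tr (unwind (q.2.2, q.1) *m adj2 (unwind (q.2.1, q.1))).
have cK : continuous K.
  have c1 : continuous (fun q : R * (R * R) => unwind (q.2.2, q.1)).
    move=> q.
    apply: (@continuous_comp _ _ _
      (fun q : R * (R * R) => (q.2.2, q.1)) unwind).
      2: exact: continuous_unwind.
    apply: (@cvg_pair _ _ _ _ (nbhs q.2.2) (nbhs q.1)); last exact: cvg_fst.
    by apply: (@continuous_comp _ _ _ snd snd); exact: cvg_snd.
  have c2 : continuous (fun q : R * (R * R) => unwind (q.2.1, q.1)).
    move=> q.
    apply: (@continuous_comp _ _ _
      (fun q : R * (R * R) => (q.2.1, q.1)) unwind).
      2: exact: continuous_unwind.
    apply: (@cvg_pair _ _ _ _ (nbhs q.2.1) (nbhs q.1)); last exact: cvg_fst.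
    by apply: (@continuous_comp _ _ _ snd fst); [exact: cvg_snd|exact: cvg_fst].
  exact: (continuous_mxtrace (continuous_mulmx c1 (continuous_adj2 c2))).
have KE s x : K (x, (s, s)) = 2.
  by rewrite /K mul_mx_adj2 det_unwind mxtrace1.
have cov := (compact_near_coveringP _).1 (@segment_compact R 0 1).
(* First compactness argument: [s] is fixed and [x] ranges over the segment. *)
have near1 (s : R) : \forall p \near (s, s), `[0, 1]%classic `<=`
    (fun x => -2 < K (x, p)).
  apply: (cov _ (nbhs (s, s)) (fun p x => -2 < K (x, p))) => x _.
  have U : nbhs (K (x, (s, s))) [set y | -2 < y].
    by apply: lt_nbhsr; rewrite KE; lra.
  exact: (cK (x, (s, s)) _ U).
(* Second compactness argument: [s] ranges over the segment, and [d] bounds the admissible distance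
   from [s] to [s']. *)
have : \forall d \near (0 : R)^'+, `[0, 1]%classic `<=`
    (fun s => forall s', `|s' - s| <= d -> `[0, 1]%classic `<=`
    (fun x => -2 < K (x, (s, s')))).
  apply: (cov _ ((0 : R)^'+) (fun d s => forall s', `|s' - s| <= d ->
    `[0, 1]%classic `<=` (fun x => -2 < K (x, (s, s'))))) => s _.
  have /nbhs_ballP[e /= e0 He] := near1 s.
  near=> s1 d => s' s'd x x01.
  apply: He x01; split => /=.
    by near: s1; exact: nbhsx_ballx.
  (* [s1] is within [e / 2] of [s] and [s'] within [d < e / 2] of [s1], so both stay in the ball of
     radius [e]. *)
  have h1 : ball s (e / 2) s1 by near: s1; apply: nbhsx_ballx; rewrite divr_gt0.
  have h2 : d < e / 2 by near: d; apply: nbhs_right_lt; rewrite divr_gt0.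
  by apply: (ball_split h1); rewrite /ball /= distrC (le_lt_trans s'd).
move=> [e /= e0 He].
have [N _ HN] := near_infty_natSinv_lt (PosNum e0).
exists N.+1 => // s s' x s01 ss' x01.
have N0 : 0 < N.+1%:R^-1 :> R by rewrite invr_gt0.
apply: (He _ _ N0 s _ s') => //.
  by rewrite /ball_ /= sub0r normrN gtr0_norm//; exact: (HN N (leqnn N)).
Unshelve. all: by end_near. Qed.

(** [unwind] is only known to be continuous in time. Its time interval is cut into [N] steps: each
    quotient of consecutive loops falls under the trace criterion, which supplies a homotopy C^1 in
    time, and the product of the quotients telescopes. *)
Lemma contractible_unwind :
  contractible (fun th => diag21 (unwind_circle 1 th) 1).
Proof.
have [N N0 HN] := unwind_close.
suff H (i : nat) : (i <= N)%N ->
    contractible (fun th => diag21 (unwind_circle (i%:R / N%:R) th) 1).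
  by have := H N (leqnn _); rewrite divff// pnatr_eq0 -lt0n.
elim: i => [_|i IH iN].
  rewrite mul0r.
  have := @contractible_cst R 1%:M (det1 _ _).
  congr contractible; apply/funext => th.
  by rewrite /unwind_circle unwind_time0.
set s := i%:R / N%:R in IH *; set s' := i.+1%:R / N%:R.
have cs : continuous (unwind_circle s) := @continuous_unwind_circle s.
have cs' : continuous (unwind_circle s') := @continuous_unwind_circle s'.
have dd th : \det (unwind_circle s' th *m adj2 (unwind_circle s th)) = 1.
  by rewrite det_mulmx det_adj2 !det_unwind mulr1.
have N0' : 0 < N%:R :> R by rewrite ltr0n.
have tt th : - 2 < \tr (unwind_circle s' th *m adj2 (unwind_circle s th)).
  apply: HN.
  - rewrite /s divr_ge0//= ler_pdivrMr// mul1r ler_nat; exact: ltnW.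
  - by rewrite /s /s' -mulrBl -natr1 addrC addKr mul1r ger0_norm// invr_ge0 ltW.
  - by rewrite fpart_ge0 ltW// fpart_lt1.
have := contractibleM (contractible_trace
  (continuous_mulmx cs' (continuous_adj2 cs)) dd tt) (IH (ltnW iN)).
congr contractible; apply/funext => th.
by rewrite diag21M mulr1 -mulmxA mul_adj2 det_unwind mulmx1.
Qed.

(** Here [F] is [unwind_circle 1] and [C = A(0)^-1]. *)
Lemma contractible_doubling : contractible (fun th => diag21 (A (th *+ 2)) 1).
Proof.
have d0 : \det (adj2 (a 0)) = 1 by rewrite det_adj2 detA.
have := contractibleM contractible_unwind (contractible_mid contA detA d0).
congr contractible; apply/funext => th.
by rewrite diag21M mulr1 unwind_circle1.
Qed.

End Doubling.

(** * Suspension of a discrete cocycle [B] whose one-step map [N] is contractible *)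

Section Suspension.
Variables (R : realType) (beta : R) (d : nat).
Variables (N : circle R -> 'M[R]_d) (B : int -> circle R -> 'M[R]_d).
Hypothesis contrN : contractible N.
Hypothesis B0 : forall th, B 0 th = 1%:M.
Hypothesis BS : forall n th,
  B (n + 1) th = N (rotation (n%:~R * beta) th) *m B n th.

Let rot (n : int) := @rotation R (n%:~R * beta).

Let rotD m n th : rot (m + n) th = rot m (rot n th).
Proof. by rewrite /rot intrD mulrDl rotationD. Qed.

Let detN th : \det (N th) = 1.
Proof.
have [H [K [G [_ _ _ tr HE]]]] := contrN.
by have [_ /(_ (lexx _))[<- _]] := HE th 1; have [] := tr (th, 1).
Qed.

Let unitN th : N th \in unitmx.
Proof. by rewrite unitmxE detN unitr1. Qed.

Lemma det_cocycle n th : \det (B n th) = 1.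
Proof.
elim/int_rect: n => [|n IH|n IH]; first by rewrite B0 det1.
  by rewrite -addn1 PoszD BS det_mulmx detN mul1r.
(* Writing [-n] as [-(n + 1) + 1] lets [BS] be read backwards. *)
move: IH; rewrite (_ : - n%:Z = - n.+1%:Z + 1); last by rewrite intS; ring.
by rewrite BS det_mulmx detN mul1r.
Qed.

(** Induction on [m] in both directions; going down, the same invertible value of [N] is cancelled
    on the left of both sides. *)
Lemma cocycleD m n th : B m (rot n th) *m B n th = B (m + n) th.
Proof.
elim/int_rect: m => [|m IH|m IH]; first by rewrite B0 mul1mx add0r.
  rewrite -addn1 PoszD BS -mulmxA IH -/(rot _ _) -rotD.
  by rewrite (_ : m%:Z + 1 + n = m%:Z + n + 1) ?BS//; ring.
move: IH; rewrite (_ : - m%:Z = - m.+1%:Z + 1); last by rewrite intS; ring.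
rewrite (_ : - m.+1%:Z + 1 + n = - m.+1%:Z + n + 1); last by ring.
rewrite !BS -mulmxA -!/(rot _ _) -rotD.
exact/can_inj/mulKmx/unitN.
Qed.

Section Flow.
Variables (H K G : circle R * R -> 'M[R]_d).
Hypothesis cG : continuous G.
Hypothesis dH : forall th (r : R),
  is_derive r 1 (fun r => H (th, r)) (G (th, r) *m H (th, r)).
Hypothesis trG : forall p, \det (H p) = 1 /\ \tr (G p) = 0.
Hypothesis HE : forall th r,
  (r <= 0 -> H (th, r) = 1%:M /\ G (th, r) = 0) /\
  (1 <= r -> H (th, r) = N th /\ G (th, r) = 0).

(** The solution started at [(th, 0)]: [B] accounts for the completed turns, and the homotopy at the
    current angle for the fraction of a turn under way. *)
Let psi th (t : R) : 'M[R]_d :=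
  H (rot (Num.floor t) th, fpart t) *m B (Num.floor t) th.

Let det_psi th t : \det (psi th t) = 1.
Proof.
rewrite det_mulmx det_cocycle mulr1.
by have [] := trG (rot (Num.floor t) th, fpart t).
Qed.

Let unit_psi th t : psi th t \in unitmx.
Proof. by rewrite unitmxE det_psi unitr1. Qed.

Let psi_int th (n : int) : psi th n%:~R = B n th.
Proof.
rewrite /psi /fpart intrKfloor subrr.
by have [/(_ (lexx _))[-> _] _] := HE (rot n th) 0; rewrite mul1mx.
Qed.

Let psi_rot th t : psi th (1 + t) = psi (rot 1 th) t *m B 1 th.
Proof.
have e : Num.floor (1 + t) = Num.floor t + 1.
  by rewrite addrC floorDrz ?floor1 ?int_num1.
by rewrite /psi e [1 + t]addrC (fpartDz t 1) -mulmxA cocycleD rotD.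
Qed.

(** Before [n] the later homotopy is still 1, and after [n] the earlier one has already reached [N].
    A single product thus describes [psi] on both sides of [n], where the floor jumps. *)
Let psi_local th (n : int) t : n%:~R - 1 < t < n%:~R + 1 ->
  H (rot n th, t - n%:~R) *m
    (H (rot (n - 1) th, t - n%:~R + 1) *m B (n - 1) th) =
  psi th t.
Proof.
move=> /andP[t1 t2]; have [nt|tn] := leP n%:~R t.
  have e : Num.floor t = n by apply: floor_def; rewrite nt intrD.
  rewrite /psi /fpart e.
  have t1' : 1 <= t - n%:~R + 1 by rewrite lerDr subr_ge0.
  have [_ /(_ t1')[-> _]] := HE (rot (n - 1) th) (t - n%:~R + 1).
  by rewrite -BS subrK.
have e : Num.floor t = n - 1.
  by apply: floor_def; rewrite subrK intrB tn ltW.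
have tn0 : t - n%:~R <= 0 by rewrite subr_le0 ltW.
have [/(_ tn0)[-> _] _] := HE (rot n th) (t - n%:~R).
by rewrite mul1mx /psi /fpart e intrB opprB addrA addrAC.
Qed.

Let is_derive_psi th (t : R) :
  is_derive t 1 (psi th) (G (rot (Num.floor t) th, fpart t) *m psi th t).
Proof.
set n := Num.floor t.
have tn : n%:~R - 1 < t < n%:~R + 1.
  rewrite -[n%:~R + 1]intrD1 floorD1_gt andbT.
  by rewrite ltrBlDr (le_lt_trans (floor_le _))// ltrDl.
have d1 := @is_derive_mx_shift R d d (fun r => H (rot n th, r)) _ (- n%:~R) t
  (dH (rot n th) (t - n%:~R)).
have d2 := @is_derive_mx_shift R d d (fun r => H (rot (n - 1) th, r + 1)) _
  (- n%:~R) t (@is_derive_mx_shift R d d (fun r => H (rot (n - 1) th, r)) _ 1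
  (t - n%:~R) (dH (rot (n - 1) th) (t - n%:~R + 1))).
have dBn := is_derive_cst (B (n - 1) th) t 1.
apply: near_eq_is_derive.
  2: apply: (is_derive_eq (is_derive_mulmx d1 (is_derive_mulmx d2 dBn))).
  near=> r; apply: psi_local.
  have : r \in `]n%:~R - 1, n%:~R + 1[.
    by near: r; apply: near_in_itvoo; rewrite in_itv.
  by rewrite in_itv.
(* As [n] is the floor of [t], the earlier homotopy is past its end and its generator is zero; only
   the current one contributes. *)
have t1 : 1 <= t - n%:~R + 1 by rewrite lerDr subr_ge0 floor_le.
have [_ /(_ t1)[_ G0]] := HE (rot (n - 1) th) (t - n%:~R + 1).
by rewrite G0 !mul0mx mulmx0 addr0 mulmx0 addr0 -(psi_local _ tn) !mulmxA.
Unshelve. all: by end_near. Qed.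

Let gen (p : circle R * unit_itv R) : 'M[R]_d := G (p.1, \val p.2).

(** [G] vanishes at times 0 and 1, so both glued points get the value 0. *)
Let gen_glue1 p q : Defs.glue1 beta p q -> gen p = gen q.
Proof.
case/and3P => /eqP p1 /eqP q0 _; rewrite /gen p1 q0.
have [_ /(_ (lexx _))[_ ->]] := HE p.1 1.
by have [/(_ (lexx _))[_ ->] _] := HE q.1 0.
Qed.

Let gen_repr p : gen (repr (\pi_(mapping_torus beta) p)) = gen p.
Proof.
case: piP => q /eqmodP /or3P[/eqP-> //|pq|qp]; first exact/esym/gen_glue1.
exact: gen_glue1.
Qed.

Let cont_gen : continuous gen.
Proof.
move=> p.
apply: (@continuous_comp _ _ _
  (fun p : circle R * unit_itv R => (p.1, \val p.2)) G).
  2: exact: cG.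
apply: (@cvg_pair _ _ _ _ (nbhs p.1) (nbhs (\val p.2))); first exact: cvg_fst.
apply: (@continuous_comp _ _ _ snd (\val : unit_itv R -> R)).
  exact: cvg_snd.
exact: (@initial_continuous _ _ set_val).
Qed.

Lemma suspension_of_homotopy : exists Phi : mapping_torus beta -> R -> 'M[R]_d,
  SL_cocycle Phi /\
  forall n th, Phi (base_point beta th) n%:~R = B n th.
Proof.
(* From height [r] on the fibre of [th], the solution is [psi] at [r + t] renormalized by its value
   at [r]. *)
exists (fun x t => let p := repr x in
  psi p.1 (\val p.2 + t) *m invmx (psi p.1 (\val p.2))); split.
  split=> [x t|]; first by rewrite det_mulmx det_inv !det_psi invr1 mulr1.
  exists (gen \o repr); split.
  (* Continuity passes to the quotient because [gen] is constant on the gluing classes. *)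
  - apply: repr_comp_continuous; first exact: cont_gen.
    move=> p q /eqP e; apply/eqP.
    by rewrite -(gen_repr p) -(gen_repr q); congr (gen (repr _)).
  - by move=> x; have [] := trG ((repr x).1, \val (repr x).2).
  - move=> x; split; first by rewrite /= addr0 mulmxV.
    move=> t /=; rewrite /susp_flow gen_repr /gen /=.
    set p := repr x.
    have dp := @is_derive_mx_shift R d d (psi p.1) _ (\val p.2) t
      (is_derive_psi p.1 (t + \val p.2)).
    under eq_fun do rewrite addrC.
    have dC := is_derive_cst (invmx (psi p.1 (\val p.2))) t 1.
    apply: (is_derive_eq (is_derive_mulmx dp dC)).
    by rewrite mulmx0 addr0 addrC mulmxA.
move=> n th; rewrite -psi_int /base_point.
have psi0 : psi th 0 = 1%:M by rewrite -[0]/(0%:~R) psi_int B0.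
case: piP => p /eqmodP /or3P[/eqP<- | pq | qp].
- by rewrite /= floor0 subrr add0r psi0 invmx1 mulmx1.
- by case/and3P: pq => /=; rewrite floor0 subrr eq_sym oner_eq0.
(* The representative of [(th, 0)] may be the point at height 1 one rotation earlier; [psi_rot] then
   produces an extra factor [B 1], removed by the normalization. *)
case/and3P: qp => /= /eqP-> _ /eqP rotp.
have -> : th = rot 1 p.1 by rewrite rotp /rot mul1r.
have -> : psi p.1 1 = B 1 p.1 by rewrite -[1]/(1%:~R) psi_int.
by rewrite psi_rot mulmxK// unitmxE det_cocycle unitr1.
Qed.

End Flow.

Lemma suspension : exists Phi : mapping_torus beta -> R -> 'M[R]_d,
  SL_cocycle Phi /\
  forall n th, Phi (base_point beta th) n%:~R = B n th.
Proof.
have [H [K [G [[_ _ cG] _ dH tr HE]]]] := contrN.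
exact: (suspension_of_homotopy cG dH tr HE).
Qed.

End Suspension.

(** * The recursion satisfied by the iterates of [A] *)

Section NStep.
Variables (R : realType) (alpha : R) (A : circle R -> 'M[R]_2).

Lemma nstep0 th : nstep alpha A 0 th = 1%:M.
Proof. exact: big_ord0. Qed.

(** One recursion over all of Z, in the form that the suspension expects. For negative [n] the
    leftmost inverse factor is split off and moved to the other side. *)
Lemma nstepS n th : (forall th, \det (A th) = 1) ->
  nstep alpha A (n + 1) th =
  A (rotation (n%:~R * alpha) th) *m nstep alpha A n th.
Proof.
move=> detA.
case: n => m.
  rewrite -PoszD addn1 /nstep big_ord_recl -mulmxE.
  congr (A (rotation (_%:~R * _) _) *m _); first by rewrite intS /=; ring.
  apply: eq_bigr => i _; congr (A (rotation (_%:~R * _) _)).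
  by rewrite /= /bump /= add1n !intS; ring.
have -> : nstep alpha A (Negz m) th =
    invmx (A (rotation ((Negz m)%:~R * alpha) th)) *m
    nstep alpha A (Negz m + 1) th.
  rewrite [LHS]/nstep big_ord_recl -mulmxE addr0; congr (_ *m _).
  (* For [n = -1] the successor is 0, whose product is empty and belongs to the nonnegative
     branch. *)
  case: m => [|m]; first by rewrite big_ord0 nstep0.
  have -> : Negz m.+1 + 1 = Negz m by rewrite !NegzE !intS; ring.
  by apply: eq_bigr => i _; congr (invmx (A (rotation (_%:~R * _) _))).
by rewrite mulKVmx// unitmxE detA unitr1.
Qed.

End NStep.

Theorem corollary3p6 (R : realType) (alpha : R) (A : circle R -> 'M[R]_2)
    (contA : continuous A) (detA : forall theta : circle R, \det (A theta) = 1) :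
  exists Phi : mapping_torus (2^-1 * alpha) -> R -> 'M[R]_3,
    SL_cocycle Phi /\
    forall (n : int) (theta : circle R) (v : 'cV[R]_2) (w : R),
      Phi (base_point (2^-1 * alpha) theta) n%:~R *m
        (col_mx v (w%:M : 'cV[R]_1) : 'cV[R]_3) =
      col_mx (nstep alpha A n (theta *+ 2) *m v) (w%:M : 'cV[R]_1).
Proof.
(* Doubling the angle carries the rotation by [alpha / 2] to the rotation by [alpha]. *)
have double n th : (rotation (n%:~R * (2^-1 * alpha)) th) *+ 2 =
    rotation (n%:~R * alpha) (th *+ 2) :> circle R.
  rewrite /rotation mulrnDl; congr (_ + _).
  by rewrite mulr2n -pi_circleD; congr (\pi_(circle R) _); field.
have := @suspension R (2^-1 * alpha) 3 _
  (fun n th => diag21 (nstep alpha A n (th *+ 2)) 1)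
  (contractible_doubling contA detA).
case=> [th|n th|Phi [SLPhi PhiE]].
- by rewrite nstep0 diag21_1.
- by rewrite nstepS// diag21M mulr1 double.
exists Phi; split=> // n th v w.
by rewrite PhiE mul_diag21_col scale1r.
Qed.
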